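(* Let $p>3$ and $0\le q<p$ be integers and let $\epsilon$ be a real number with $1<\epsilon\le\frac12\|(p,q)\|$. Let $c_{p,q}(t)=(1-t)^2(p,q)+t^2(q,p)$, $0\le t\le 1$, be the quadratic Bézier curve corresponding to $P_0=(p,q)$, $P_1=(0,0)$, $P_2=(q,p)$. If $(r,s)$ is a pair of coprime positive integers with $\|(r,s)-(p,q)\|\le\epsilon-1$, then there exists $0<t_{r,s}<1$ such that $\|L_{r,s}(t_{r,s})-c_{p,q}(t_{r,s})\|<\epsilon$.
   Context: For a pair of coprime positive integers $(p,q)$, the Bézout coefficients $\mathcal B(p,q)=(a,b)$ are the unique pair of integers with $0<a\le p$, $0\le b<q$ and $aq-bp=1$. For coprime positive integers $(r,s)$, the Bézier–Bézout segment is $L_{r,s}(t)=(1-t)\,\mathcal B(r,s)+t\,\mathcal B(s,r)$, $0\le t\le 1$. Norms are Euclidean. *)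

(* Defs.v *)
From Stdlib Require Import Reals ZArith Znumtheory Lia Lra ClassicalEpsilon.
From Coquelicot Require Import Coquelicot.

Open Scope R_scope.

Definition is_bezout (p q : Z) (ab : Z * Z) : Prop :=
  (0 < fst ab <= p /\ 0 <= snd ab < q /\ fst ab * q - snd ab * p = 1)%Z.

Lemma is_bezout_exists (p q : Z) :
  (0 < p)%Z -> (0 < q)%Z -> rel_prime p q -> exists ab, is_bezout p q ab.
Proof.
intros hp hq hpq.
destruct (rel_prime_bezout _ _ hpq) as [u v huv].
pose proof (Z.div_mod (v - 1) p ltac:(lia)) as hd.
pose proof (Z.mod_pos_bound (v - 1) p hp) as hm.
set (k := ((v - 1) / p)%Z) in *.
set (m := ((v - 1) mod p)%Z) in *.
exists (m + 1, - (u + k * q))%Z.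
unfold is_bezout; cbn [fst snd].
assert (e : ((m + 1) * q - - (u + k * q) * p = 1)%Z).
{ replace (m + 1)%Z with (v - p * k)%Z by lia. lia. }
split; [lia | split; [| exact e]].
generalize dependent (- (u + k * q))%Z; intros b e; split; nia.
Qed.

Lemma is_bezout_unique (p q : Z) (ab cd : Z * Z) :
  is_bezout p q ab -> is_bezout p q cd -> ab = cd.
Proof.
destruct ab as [a b], cd as [c d]; unfold is_bezout; cbn [fst snd].
intros (ha & hb & e) (hc & hd & f).
assert (g : ((a - c) * q = (b - d) * p)%Z) by lia.
assert (hrel : rel_prime p q).
{ apply bezout_rel_prime; apply Bezout_intro with (- b)%Z a; lia. }
assert (hdiv : (p | a - c)%Z).
{ apply Gauss with q; [exists (b - d)%Z; lia | exact hrel]. }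
destruct hdiv as [k hk].
assert (k = 0)%Z by nia; subst k.
f_equal; nia.
Qed.

(* For (p, q) not a pair of coprime positive integers the value is
   unspecified. *)
Definition bezout (p q : Z) : Z * Z :=
  epsilon (inhabits (0, 0)%Z) (is_bezout p q).

Lemma bezout_spec (p q : Z) :
  (0 < p)%Z -> (0 < q)%Z -> rel_prime p q -> is_bezout p q (bezout p q).
Proof.
intros hp hq hpq; unfold bezout; apply epsilon_spec.
now apply is_bezout_exists.
Qed.

(* Coquelicot's norm on a product is the square root of the sum of the squared
   norms of the components, so the norm of [R2] is the Euclidean one. *)
Definition R2 : NormedModule R_AbsRing :=
  prod_NormedModule R_AbsRing R_NormedModule R_NormedModule.

Lemma norm_R2 (x y : R) : norm ((x, y) : R2) = sqrt (x ^ 2 + y ^ 2).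
Proof.
change (sqrt (Rabs x ^ 2 + Rabs y ^ 2) = sqrt (x ^ 2 + y ^ 2)).
now rewrite !pow2_abs.
Qed.

Definition pt (z : Z * Z) : R2 := (IZR (fst z), IZR (snd z)).

Definition bezier_bezout_segment (r s : Z) (t : R) : R2 :=
  plus (scal (1 - t) (pt (bezout r s))) (scal t (pt (bezout s r))).

Definition quadratic_bezier (P0 P1 P2 : R2) (t : R) : R2 :=
  plus (plus (scal ((1 - t) ^ 2) P0) (scal (2 * (1 - t) * t) P1))
       (scal (t ^ 2) P2).

Definition c_curve (p q : Z) : R -> R2 :=
  quadratic_bezier (pt (p, q)) (pt (0, 0)%Z) (pt (q, p)).

Lemma c_curveE (p q : Z) (t : R) :
  c_curve p q t =
  plus (scal ((1 - t) ^ 2) (pt (p, q))) (scal (t ^ 2) (pt (q, p))).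
Proof.
unfold c_curve, quadratic_bezier.
apply (f_equal (fun v : R2 => plus v (scal (t ^ 2) (pt (q, p))))).
transitivity (plus (scal ((1 - t) ^ 2) (pt (p, q))) (zero : R2)).
- apply (f_equal (plus (scal ((1 - t) ^ 2) (pt (p, q))))).
  exact (scal_zero_r (V := R2) (2 * (1 - t) * t)).
- exact (plus_zero_r (G := R2) _).
Qed.

(* Main.v *)
(** Write [(a, b) = B(r, s)]; then [B(s, r) = (s - b, r - a)].  As
    [a s - b r = 1], the point [(a, b)] is [(a / r) (r, s) - (0, 1 / r)], so at
    [1 - t = a / r] the segment [L_{r,s}] meets [c_{r,s}] up to the error
    [(1 / r) (t, - (1 - t))], of norm less than [1]; the parameter is interior
    unless [r = 1], in which case [b / s] plays the role of [a / r].  Moreover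
    [c_{r,s}(t)] and [c_{p,q}(t)] are at distance at most
    [((1 - t)^2 + t^2) ||(r, s) - (p, q)||], and the triangle inequality
    concludes.  Only [r = s = 1] escapes the argument, and it would force
    [||(p, q)|| < 2]. *)

Require Import Defs.
From Stdlib Require Import Reals ZArith Znumtheory Lia Lra.
From Coquelicot Require Import Coquelicot.

Open Scope R_scope.

(** With [(a, b)] the coefficients of [(r, s)], one has [(s - b) r - (r - a) s = a s - b r = 1], and
    the half-open ranges [0 < a <= r] and [0 <= b < s] turn into [0 <= r - a < r] and
    [0 < s - b <= s]; uniqueness concludes. *)
Lemma bezout_swap (r s : Z) :
  (0 < r)%Z -> (0 < s)%Z -> rel_prime r s ->
  bezout s r = (s - snd (bezout r s), r - fst (bezout r s))%Z.
Proof.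
intros hr hs hrs.
apply (is_bezout_unique s r).
- apply bezout_spec; trivial; now apply rel_prime_sym.
- destruct (bezout_spec r s hr hs hrs) as (ha & hb & e).
  unfold is_bezout; cbn [fst snd]; lia.
Qed.

Lemma norm_swap_R2 (v : R2) : norm ((snd v, fst v) : R2) = norm v.
Proof.
destruct v as [x y]; cbn [fst snd].
rewrite !norm_R2; f_equal; ring.
Qed.

Lemma norm_R2_lt_1 (x y : R) : x ^ 2 + y ^ 2 < 1 -> norm ((x, y) : R2) < 1.
Proof.
intros h; rewrite norm_R2, <- sqrt_1.
apply sqrt_lt_1; nra.
Qed.

(** The difference of the curves combines [v] and its mirror image in the diagonal, and that
    reflection is an isometry. *)
Lemma c_curve_dist (p q r s : Z) (t : R) :
  norm (minus (c_curve r s t) (c_curve p q t)) <=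
  ((1 - t) ^ 2 + t ^ 2) * norm (minus (pt (r, s)) (pt (p, q))).
Proof.
set (v := minus (pt (r, s)) (pt (p, q))).
assert (e : minus (c_curve r s t) (c_curve p q t) =
            plus (scal ((1 - t) ^ 2) v) (scal (t ^ 2) ((snd v, fst v) : R2))).
{ rewrite !c_curveE; unfold v; apply injective_projections;
    cbv [minus plus opp scal mult pt fst snd] ; simpl;
    cbv [plus opp scal mult]; simpl; cbv [mult]; simpl; ring. }
rewrite e, Rmult_plus_distr_r.
eapply Rle_trans; [apply (norm_triangle (V := R2))|].
apply Rplus_le_compat.
- eapply Rle_trans; [apply (norm_scal (V := R2))|].
  change (abs ((1 - t) ^ 2)) with (Rabs ((1 - t) ^ 2)).
  rewrite Rabs_pos_eq by apply pow2_ge_0; apply Rle_refl.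
- eapply Rle_trans; [apply (norm_scal (V := R2))|].
  change (abs (t ^ 2)) with (Rabs (t ^ 2)).
  rewrite Rabs_pos_eq by apply pow2_ge_0; rewrite norm_swap_R2; apply Rle_refl.
Qed.

(** For [r = s = 1] both candidates [1 - a / r] and [1 - b / s] are endpoints, namely 0 and 1; the
    last hypothesis keeps one of them interior. *)
Lemma segment_near_own_curve (r s : Z) :
  (0 < r)%Z -> (0 < s)%Z -> rel_prime r s -> (1 < r \/ 1 < s)%Z ->
  exists t : R, 0 < t < 1 /\
    norm (minus (bezier_bezout_segment r s t) (c_curve r s t)) < 1.
Proof.
intros hr hs hrs h1.
pose proof (bezout_spec r s hr hs hrs) as hB.
pose proof (bezout_swap r s hr hs hrs) as hS.
destruct (bezout r s) as [a b] eqn:E.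
destruct hB as (ha & hb & e); cbn [fst snd] in *.
assert (eR : IZR a * IZR s - IZR b * IZR r = 1)
  by (rewrite <- !mult_IZR, <- minus_IZR; now rewrite e).
assert (hsplit : forall t x y : R,
  (1 - t) * IZR a + t * (IZR s - IZR b)
    = (1 - t) ^ 2 * IZR r + t ^ 2 * IZR s + x ->
  (1 - t) * IZR b + t * (IZR r - IZR a)
    = (1 - t) ^ 2 * IZR s + t ^ 2 * IZR r + y ->
  minus (bezier_bezout_segment r s t) (c_curve r s t) = ((x, y) : R2)).
{ intros t x y hx hy.
  rewrite c_curveE; unfold bezier_bezout_segment; rewrite hS, E.
  apply injective_projections;
    cbv [minus plus opp scal mult pt fst snd]; simpl;
    cbv [plus opp scal mult]; simpl; cbv [mult]; simpl;
    rewrite !minus_IZR; lra. }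
assert (hpos : forall m n : Z, (0 < m < n)%Z -> 0 < 1 - IZR m / IZR n < 1).
{ intros m n [h h'].
  apply IZR_lt in h; apply IZR_lt in h'.
  assert (0 < IZR m / IZR n) by (apply Rdiv_lt_0_compat; lra).
  assert (IZR m / IZR n < 1) by (apply Rlt_div_l; lra).
  lra. }
assert (herr : forall (n : Z) (t : R), (1 < n)%Z -> 0 < t < 1 ->
  (t / IZR n) ^ 2 + ((1 - t) / IZR n) ^ 2 < 1).
{ intros n t hn ht; apply IZR_lt in hn.
  assert (0 < / IZR n < 1).
  { split; [apply Rinv_0_lt_compat; lra|].
    rewrite <- Rinv_1; apply Rinv_lt_contravar; lra. }
  unfold Rdiv.
  assert ((/ IZR n) ^ 2 < 1) by nra.
  assert (t ^ 2 + (1 - t) ^ 2 < 1) by nra.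
  assert (0 < t ^ 2 + (1 - t) ^ 2) by nra.
  replace ((t * / IZR n) ^ 2 + ((1 - t) * / IZR n) ^ 2)
    with ((/ IZR n) ^ 2 * (t ^ 2 + (1 - t) ^ 2)) by ring.
  nra. }
assert (hrR : 0 < IZR r) by now apply IZR_lt.
assert (hsR : 0 < IZR s) by now apply IZR_lt.
destruct (Z_lt_le_dec 1 r) as [h|h].
(* [a = r] would give [r (s - b) = 1], impossible for [r > 1]; so [0 < a < r]. *)
- assert (ht : 0 < 1 - IZR a / IZR r < 1) by (apply hpos; nia).
  exists (1 - IZR a / IZR r); split; [exact ht|].
  set (t := 1 - IZR a / IZR r) in *.
  assert (eb : IZR b = (IZR a * IZR s - 1) / IZR r)
    by (field_simplify_eq; lra).
  rewrite (hsplit t (t / IZR r) (- ((1 - t) / IZR r))).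
  + apply norm_R2_lt_1; pose proof (herr r t h ht); nra.
  + rewrite eb; unfold t; field; lra.
  + rewrite eb; unfold t; field; lra.
- assert (h' : (1 < s)%Z) by lia.
  (* Now [r = 1] forces [a = 1], hence [b = s - 1], which is positive since [s > 1]. *)
  assert (ht : 0 < 1 - IZR b / IZR s < 1) by (apply hpos; nia).
  exists (1 - IZR b / IZR s); split; [exact ht|].
  set (t := 1 - IZR b / IZR s) in *.
  assert (ea : IZR a = (IZR b * IZR r + 1) / IZR s)
    by (field_simplify_eq; lra).
  rewrite (hsplit t ((1 - t) / IZR s) (- (t / IZR s))).
  + apply norm_R2_lt_1; pose proof (herr s t h' ht); nra.
  + rewrite ea; unfold t; field; lra.
  + rewrite ea; unfold t; field; lra.
Qed.

Lemma unit_pair_far (p q : Z) (eps : R) :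
  (3 < p)%Z -> eps <= / 2 * norm (pt (p, q)) ->
  ~ norm (minus (pt (1, 1)%Z) (pt (p, q))) <= eps - 1.
Proof.
intros hp heps h.
set (u := pt (1, 1)%Z) in *; set (v := pt (p, q)) in *.
assert (hu : norm u < 2).
{ unfold u, pt; cbn [fst snd]; rewrite norm_R2.
  replace 2 with (sqrt (2 ^ 2)) by (apply sqrt_pow2; lra).
  apply sqrt_lt_1; lra. }
assert (hv : 3 < norm v).
{ unfold v, pt; cbn [fst snd]; rewrite norm_R2.
  apply IZR_lt in hp.
  replace 3 with (sqrt (3 ^ 2)) by (apply sqrt_pow2; lra).
  apply sqrt_lt_1; nra. }
assert (htri : norm v <= norm u + norm (minus u v)).
{ replace v with (minus u (minus u v)) at 1.
  - unfold minus at 1; eapply Rle_trans; [apply (norm_triangle (V := R2))|].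
    rewrite (norm_opp (V := R2)); apply Rle_refl.
  - apply injective_projections; cbv [minus plus opp]; simpl;
      cbv [plus opp]; simpl; ring. }
(* Inserting [h] and [heps] into [htri] yields [norm v <= 2 * norm u - 2 < 2], against [hv]. *)
lra.
Qed.

Theorem theorem1 (p q : Z) (eps : R)
    (hp : (3 < p)%Z) (hq : (0 <= q < p)%Z)
    (heps : 1 < eps <= / 2 * norm (pt (p, q)))
    (r s : Z) (hr : (0 < r)%Z) (hs : (0 < s)%Z) (hrs : rel_prime r s)
    (hdist : norm (minus (pt (r, s)) (pt (p, q))) <= eps - 1) :
  exists t : R, 0 < t < 1 /\
    norm (minus (bezier_bezout_segment r s t) (c_curve p q t)) < eps.
Proof.
assert (h1 : (1 < r \/ 1 < s)%Z).
{ destruct (Z_lt_le_dec 1 r) as [h|h]; [now left|].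
  destruct (Z_lt_le_dec 1 s) as [h'|h']; [now right|exfalso].
  replace r with 1%Z in hdist by lia; replace s with 1%Z in hdist by lia.
  now apply (unit_pair_far p q eps hp (proj2 heps)). }
destruct (segment_near_own_curve r s hr hs hrs h1) as (t & ht & hL).
exists t; split; [exact ht|].
rewrite (minus_trans (G := R2) (c_curve r s t)).
eapply Rle_lt_trans; [apply (norm_triangle (V := R2))|].
pose proof (c_curve_dist p q r s t) as hc.
pose proof (norm_ge_0 (minus (pt (r, s)) (pt (p, q)))) as h0.
(* The two errors add up to less than [1 + (eps - 1)]; strictness comes from [hL]. *)
assert ((1 - t) ^ 2 + t ^ 2 <= 1) by nra.
nra.
Qed.
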